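(* Let $q = ef+1$ be prime, where $e,f$ are positive integers, let $C_0,\dots,C_{e-1}$ be the cyclotomic classes of index $e$ in $\mathbb{F}_q$ (with respect to a primitive element $\alpha$), and let $(i,j)_e$ denote the cyclotomic numbers of order $e$. Let $\lambda = \max\{(i, i+1 \bmod e)_e : 0 \leq i \leq e-1\}$. Then $\mathcal{A} = \{C_0,\dots,C_{e-1}\}$ is an $\epsilon$-secure strong circular $(q,e,f)$-AMD code (in the additive group of $\mathbb{F}_q$), where $\epsilon = \lambda/f$.
   Context: Let $q=ef+1$ and let $\alpha\in\mathbb{F}_q$ be a primitive element. Define $C_0=\{\alpha^{je}: 0\leq j\leq f-1\}$ and $C_i=\alpha^iC_0$ for $1\leq i\leq e-1$; these are the cyclotomic classes of index $e$. The cyclotomic numbers of order $e$ are the integers $(i,j)_e=|(C_i+1)\cap C_j|$ for $0\leq i,j\leq e-1$, where $S+x=\{s+x:s\in S\}$. Let $\mathcal{G}$ be an additive abelian group of order $n$ and let $A_0,\dots,A_{m-1}$ be $m$ pairwise disjoint $\ell$-subsets of $\mathcal{G}$. The family is an $\epsilon$-secure strong circular $(n,m,\ell)$-AMD code if an adversary cannot win the following game with probability greater than $\epsilon$: (1) the source $i\in\{0,\dots,m-1\}$ is specified and given to the adversary; (2) the adversary chooses $\Delta\in\mathcal{G}\setminus\{0\}$; (3) $g$ is chosen uniformly at random from $A_i$; (4) the adversary wins if and only if $g+\Delta\in A_j$ where $j=i+1\bmod m$. That is, for every $i$ and every $\Delta\neq 0$, $|(A_i+\Delta)\cap A_{i+1\bmod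 m}|/\ell\leq\epsilon$. *)

(* Defs.v *)
From mathcomp Require Import all_boot all_order all_fingroup all_algebra all_solvable.

Set Implicit Arguments.
Unset Strict Implicit.
Unset Printing Implicit Defensive.

Import Order.TTheory GRing.Theory Num.Theory.
Local Open Scope ring_scope.

Section Cyclotomy.

Variable F : finFieldType.

Definition primitive_element (a : F) : Prop :=
  exists2 u : {unit F}, a = val u & generator [set: {unit F}] u.

Definition translate (G : finZmodType) (S : {set G}) (x : G) : {set G} :=
  [set s + x | s in S].

Definition cyclotomic_class0 (e f : nat) (a : F) : {set F} :=
  [set a ^+ (j * e) | j : 'I_f].

Definition cyclotomic_class (e f : nat) (a : F) (i : nat) : {set F} :=
  [set a ^+ i * x | x in cyclotomic_class0 e f a].

Definition cyclotomic_number (e f : nat) (a : F) (i j : nat) : nat :=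
  #|translate (cyclotomic_class e f a i) 1 :&: cyclotomic_class e f a j|.

End Cyclotomy.

Section AMDCodes.

Variable G : finZmodType.

(* Probability, for g uniform in A i, that g + Delta lands in A (i + 1 mod m);
   ordS is the cyclic successor on 'I_m. *)
Definition win_prob (m : nat) (A : 'I_m -> {set G}) (i : 'I_m) (Delta : G)
    : rat :=
  #|[set g in A i | g + Delta \in A (ordS i)]|%:R / #|A i|%:R.

Lemma win_probE (m : nat) (A : 'I_m -> {set G}) (i : 'I_m) (Delta : G) :
  win_prob A i Delta =
  #|translate (A i) Delta :&: A (ordS i)|%:R / #|A i|%:R.
Proof.
rewrite /win_prob -(card_imset _ (addIr Delta)); congr (_%:R / _).
apply: eq_card => y; rewrite inE; apply/imsetP/andP.
  by case=> x /[!inE] /andP[xA xD] ->; split=> //; apply/imsetP; exists x.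
by case=> /imsetP[x xA ->] xD; exists x => //; rewrite inE xA.
Qed.

Definition strong_circular_AMD_code (n m l : nat) (eps : rat)
    (A : 'I_m -> {set G}) : Prop :=
  [/\ #|G| = n,
      forall i, #|A i| = l,
      forall i j, i != j -> [disjoint A i & A j]
    & forall i (Delta : G), Delta != 0 -> win_prob A i Delta <= eps].

End AMDCodes.

Arguments strong_circular_AMD_code {G} n m l eps A.

(* Main.v *)
(** Multiplication by [Delta^-1 = alpha^-k] maps [C_i + Delta] and [C_(i+1)] to
    [C_(i-k) + 1] and [C_(i+1-k)], so each winning probability is a cyclotomic
    number [(s, s+1)_e] divided by [f]. *)
Require Import Defs.
From mathcomp Require Import all_boot all_order all_fingroup all_algebra all_solvable.

Set Implicit Arguments.
Unset Strict Implicit.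
Unset Printing Implicit Defensive.

Import Order.TTheory GRing.Theory Num.Theory.
Local Open Scope ring_scope.

Lemma val_unitX (F : finFieldType) (u : {unit F}) (k : nat) :
  val (u ^+ k)%g = val u ^+ k.
Proof. by elim: k => [|k IHk]; rewrite ?expg0 // expgS exprS /= IHk. Qed.

Lemma primitive_element_unity_root (F : finFieldType) (a : F) :
  primitive_element a -> #|F|.-1.-primitive_root a.
Proof.
case=> u -> /eqP gen_u.
have ord_u : #|F|.-1 = #[u]%g by rewrite -card_finField_unit orderE -gen_u.
rewrite /primitive_root_of_unity ord_u order_gt0 /=.
(* Each exponent [k.+1] tested here is at most the order of [u], so divisibility by that order
   forces equality with it. *)
apply/forallP=> k; apply/eqP; rewrite unity_rootE -val_unitX.
have -> : (val (u ^+ k.+1)%g == 1) = (u ^+ k.+1 == 1)%g by [].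
rewrite -order_dvdn; apply/idP/eqP=> [dvd|->//].
by apply/eqP; rewrite eqn_leq ltn_ord dvdn_leq.
Qed.

(** Discrete logarithm. The bound on [k] later keeps a subtraction of exponents from truncating. *)
Lemma primitive_element_log (F : finFieldType) (a x : F) :
  primitive_element a -> x != 0 -> exists2 k, (k < #|F|.-1)%N & x = a ^+ k.
Proof.
case=> u -> /eqP gen_u; rewrite -unitfE => x_unit.
have: FinRing.unit F x_unit \in <[u]>%g by rewrite -gen_u inE.
case/cyclePmin=> k ltk /(congr1 val) /= Dx; exists k; last by rewrite Dx val_unitX.
by rewrite -card_finField_unit gen_u.
Qed.

Section CyclotomicClasses.

Variables (F : finFieldType) (e f : nat) (a : F).
Hypotheses (e_gt0 : (0 < e)%N) (f_gt0 : (0 < f)%N).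
Hypothesis a_root : (e * f).-primitive_root a.

Let C := cyclotomic_class e f a.

(** Since [e] divides the order [e * f] of [a], an exponent of [a] has a well-defined residue modulo
    [e], and this residue alone decides the class. Later arguments thus reduce to congruences. *)
Lemma mem_cyclotomic_class i x :
  reflect (exists2 k, k = i %[mod e] & x = a ^+ k) (x \in C i).
Proof.
apply: (iffP imsetP) => [[_ /imsetP[j _ ->] ->]|[k ki ->]].
  by exists (j * e + i)%N; rewrite ?modnMDl // addnC exprD.
(* Adding a multiple of the order of [a] leaves the power unchanged and makes the exponent large
   enough to subtract [i] in the naturals. *)
have le_ik : (i <= i * (e * f) + k)%N.
  by apply: leq_trans (leq_addr _ _); rewrite leq_pmulr // muln_gt0 e_gt0.
have /dvdnP[t Dt] : (e %| i * (e * f) + k - i)%N.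
  by rewrite -eqn_mod_dvd // [(e * f)%N]mulnC mulnA modnMDl ki.
(* Reducing [t] modulo [f] changes [t * e] by a multiple of [e * f] only, and gives an index in
   ['I_f]. *)
exists (a ^+ (t %% f * e)).
  by apply/imsetP; exists (Ordinal (ltn_pmod t f_gt0)).
rewrite -exprD; apply/eqP; rewrite (eq_prim_root_expr a_root).
rewrite -(modnMDl i k) -(subnKC le_ik) Dt eqn_modDl.
by rewrite muln_modl [(f * e)%N]mulnC modn_mod.
Qed.

Lemma mem_expr_cyclotomic_class i k : (a ^+ k \in C i) = (k == i %[mod e]).
Proof.
apply/mem_cyclotomic_class/eqP => [[l li /eqP]|ki]; last by exists k.
rewrite (eq_prim_root_expr a_root) => /eqP kl.
by rewrite -li -(modn_dvdm k (dvdn_mulr f (dvdnn e))) kl modn_dvdm ?dvdn_mulr.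
Qed.

Lemma eq_cyclotomic_class i j : i = j %[mod e] -> C i = C j.
Proof.
move=> ij; apply/setP=> x.
by apply/mem_cyclotomic_class/mem_cyclotomic_class=> -[k ki ->];
  exists k; rewrite // ki ij.
Qed.

Lemma disjoint_cyclotomic_class i j :
  i != j %[mod e] -> [disjoint C i & C j].
Proof.
move=> ij; apply/pred0P=> x /=; apply: contraNF ij.
case/andP=> /mem_cyclotomic_class[k ki ->].
by rewrite mem_expr_cyclotomic_class ki.
Qed.

Lemma unity_root_expr_neq0 k : a ^+ k != 0.
Proof. by rewrite expf_neq0 // (prim_root_eq0 a_root) -lt0n muln_gt0 e_gt0. Qed.

(** The exponents [j * e] with [j < f] are distinct modulo the order [e * f], and multiplication by
    [a ^+ i] is injective. *)
Lemma card_cyclotomic_class i : #|C i| = f.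
Proof.
rewrite card_imset; last exact: mulfI (unity_root_expr_neq0 i).
rewrite card_imset ?card_ord // => j k /eqP.
rewrite (eq_prim_root_expr a_root) [(e * f)%N]mulnC -!muln_modl eqn_pmul2r //.
by rewrite !modn_small // => /eqP/val_inj.
Qed.

Lemma cyclotomic_class_scale d i : C (i + d) = [set a ^+ d * x | x in C i].
Proof.
apply/setP=> y; apply/mem_cyclotomic_class/imsetP.
  case=> k kid ->.
  have le_d : (d <= k + d * (e * f))%N.
    by apply: leq_trans (leq_addl _ _); rewrite leq_pmulr // muln_gt0 e_gt0.
  exists (a ^+ (k + d * (e * f) - d)).
    rewrite mem_expr_cyclotomic_class -(eqn_modDr d) subnK //.
    by rewrite addnC [(e * f)%N]mulnC mulnA modnMDl kid.
  rewrite -exprD subnKC // exprD mulnC exprM (prim_expr_order a_root).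
  by rewrite expr1n mulr1.
case=> _ /mem_cyclotomic_class[k ki ->] ->.
by exists (d + k)%N; rewrite ?exprD // addnC -modnDml ki modnDml.
Qed.

Lemma translate_cyclotomic_class_scale d i :
  translate (C (i + d)) (a ^+ d) =
  [set a ^+ d * x | x in translate (C i) 1].
Proof.
rewrite /translate cyclotomic_class_scale -!imset_comp.
by apply: eq_imset => x /=; rewrite mulrDr mulr1.
Qed.

(** Multiplication by [a ^+ d] is injective, so it commutes with intersection and preserves
    cardinality. Writing the indices as [i + d] and [j + d] avoids negative exponents. *)
Lemma card_translate_cyclotomic_class d i j :
  #|translate (C (i + d)) (a ^+ d) :&: C (j + d)| = cyclotomic_number e f a i j.
Proof.
have injM := mulfI (unity_root_expr_neq0 d).
rewrite translate_cyclotomic_class_scale cyclotomic_class_scale.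
by rewrite -(imsetI (in2W injM)) card_imset.
Qed.

Lemma eq_cyclotomic_number i i' j j' :
  i = i' %[mod e] -> j = j' %[mod e] ->
  cyclotomic_number e f a i j = cyclotomic_number e f a i' j'.
Proof.
by move=> /eq_cyclotomic_class + /eq_cyclotomic_class;
  rewrite /C /cyclotomic_number => -> ->.
Qed.

Lemma strong_circular_AMD_cyclotomic_classes :
  primitive_element a -> #|F| = (e * f + 1)%N ->
  strong_circular_AMD_code #|F| e f
    ((\max_(i < e) cyclotomic_number e f a i ((i + 1) %% e))%:R / f%:R)
    (fun i : 'I_e => cyclotomic_class e f a i).
Proof.
move=> a_prim cardF; split=> // [i|i j ij|i Delta Delta_neq0].
- exact: card_cyclotomic_class.
- by apply: disjoint_cyclotomic_class; rewrite !modn_small.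
have [d ltd ->] := primitive_element_log a_prim Delta_neq0.
have le_d : (d <= i + e * f)%N.
  by move: ltd; rewrite cardF addn1 => /ltnW/leq_trans; apply; rewrite leq_addl.
(* [s] stands for [i - d] modulo [e]; the summand [e * f] exceeds [d]. *)
pose s := (i + e * f - d)%N.
have sdE : (s + d = i %[mod e])%N by rewrite subnK // mulnC addnC modnMDl.
rewrite win_probE card_cyclotomic_class.
rewrite ler_pM2r ?invr_gt0 ?ltr0n // ler_nat.
rewrite -/C -(eq_cyclotomic_class sdE).
rewrite -(@eq_cyclotomic_class (s + 1 + d) (ordS i)); last first.
  by rewrite addnAC -modnDml sdE modnDml /= modn_mod addn1.
rewrite card_translate_cyclotomic_class.
(* The maximum ranges over reduced indices, so both indices are brought below [e]. *)
rewrite (@eq_cyclotomic_number s (s %% e) (s + 1) ((s %% e + 1) %% e)).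
- exact: (leq_bigmax (Ordinal (ltn_pmod s e_gt0))).
- by rewrite modn_mod.
- by rewrite modn_mod modnDml.
Qed.

End CyclotomicClasses.

Theorem theorem3p2 (q e f : nat) (e_gt0 : (0 < e)%N) (f_gt0 : (0 < f)%N)
    (q_def : q = (e * f + 1)%N) (q_prime : prime q)
    (alpha : 'F_q) (alpha_prim : primitive_element alpha) :
  let lambda := (\max_(i < e) cyclotomic_number e f alpha i ((i + 1) %% e))%N in
  strong_circular_AMD_code q e f (lambda%:R / f%:R)
    (fun i : 'I_e => cyclotomic_class e f alpha i).
Proof.
(* ['F_q] is built on the least prime factor of [q], so its cardinality is [q] because [q] is
   prime. *)
have cardF : #|'F_q| = (e * f + 1)%N by rewrite card_Fp.
have a_root := primitive_element_unity_root alpha_prim.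
rewrite cardF addn1 /= in a_root.
have := strong_circular_AMD_cyclotomic_classes e_gt0 f_gt0 a_root alpha_prim cardF.
by rewrite card_Fp.
Qed.
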